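(* Let $m,n$ be positive integers, $M=\{1,\dots,m\}$, $N=\{1,\dots,n\}$, $A\in\mathbb{R}^{M\times N}$ with $\mathrm{rk}(A)=m$, $b\in\mathbb{R}^M$, $u\in(\mathbb{R}\cup\{\infty\})^N$, and $\mathbf B(u)=\{x\in\mathbb{R}^N:\mathbf 0\le x\le u\}$. Consider any subroutine $\mathrm{Update}:\mathbf B(u)\to\mathbf B(u)$ with the property that, for $y=\mathrm{Update}(x)$, one has $y=x$ if and only if $x$ is optimal for $$\min\{\tfrac12\|Ax-b\|^2: x\in\mathbf B(u)\},$$ and $\|Ay-b\|<\|Ax-b\|$ otherwise; and consider any centroid mapping $\Psi$. Then the Update-and-Stabilize algorithm (described in the context) run with $\mathrm{Update}$ and $\Psi$ from any initial point of $\mathbf B(u)$ finds an optimal solution to this problem within $3^n$ major cycles. Every major cycle contains at most $n$ minor cycles.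
   Context: $\|\cdot\|$ is the Euclidean norm. **Centroid mappings.** For $x\in\mathbf B(u)$ let $I_0(x)=\{i\in N:x(i)=0\}$, $I_1(x)=\{i\in N:x(i)=u(i)\}$. Let $\mathbf L(I_0(x),I_1(x))=\{y\in\mathbb{R}^N: y(i)=0\ \forall i\in I_0(x),\ y(i)=u(i)\ \forall i\in I_1(x)\}$ and let the centroid set be $\mathcal C(I_0(x),I_1(x))=\arg\min_y\{\|Ay-b\|: y\in\mathbf L(I_0(x),I_1(x))\}$. A centroid mapping is a map $\Psi:\mathbf B(u)\to\mathbb{R}^N$ with $\Psi(x)\in\mathcal C(I_0(x),I_1(x))$ for all $x\in\mathbf B(u)$ and $\Psi(\Psi(x))=\Psi(x)$ whenever $\Psi(x)\in\mathbf B(u)$. **Algorithm.** Start from an initial point $x\in\mathbf B(u)$. Repeat the following major cycle until $x=\mathrm{Update}(x)$, then return $x$: set $x\leftarrow\mathrm{Update}(x)$; then, while $\Psi(x)\neq x$, perform a minor cycle: let $w=\Psi(x)$, let $\alpha^*$ be the largest $\alpha\in[0,1]$ with $x+\alpha(w-x)\in\mathbf B(u)$, and set $x\leftarrow x+\alpha^*(w-x)$. The condition $x=\mathrm{Update}(x)$ is tested at the end of each major cycle. *)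

(* Defs.v *)
From HB Require Import structures.
From mathcomp Require Import all_boot all_order all_algebra.
From mathcomp Require Import all_classical all_reals.

Set Implicit Arguments.
Unset Strict Implicit.
Unset Printing Implicit Defensive.

Import Order.TTheory GRing.Theory Num.Theory.
Local Open Scope classical_set_scope.
Local Open Scope ring_scope.

Section BoxLeastSquares.
Variables (R : realType) (m n : nat).
Implicit Types (A : 'M[R]_(m, n)) (b : 'cV[R]_m) (u : 'I_n -> \bar R).
Implicit Types (x y z w : 'cV[R]_n).
Implicit Types (Update Psi : 'cV[R]_n -> 'cV[R]_n).

(* MathComp-Analysis' norm `|v| on matrices is the sup norm, hence this one. *)
Definition norm2 (k : nat) (v : 'cV[R]_k) : R :=
  Num.sqrt (\sum_(i < k) v i 0 ^+ 2).

Definition box u : set 'cV[R]_n :=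
  [set x | forall i, 0 <= x i 0 /\ ((x i 0)%:E <= u i)%E].

Definition objective A b x : R := 2^-1 * norm2 (A *m x - b) ^+ 2.

Definition optimal A b u x : Prop :=
  box u x /\ forall z, box u z -> objective A b x <= objective A b z.

Definition tight_lower x : {set 'I_n} := [set i | x i 0 == 0]%SET.

Definition tight_upper u x : {set 'I_n} := [set i | (x i 0)%:E == u i]%SET.

Definition face_space u (I0 I1 : {set 'I_n}) : set 'cV[R]_n :=
  [set y | (forall i, i \in I0 -> y i 0 = 0) /\
           (forall i, i \in I1 -> (y i 0)%:E = u i)].

Definition centroid_set A b u (I0 I1 : {set 'I_n}) : set 'cV[R]_n :=
  [set y | face_space u I0 I1 y /\
     forall z, face_space u I0 I1 z ->
       norm2 (A *m y - b) <= norm2 (A *m z - b)].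

(* Maps defined on the box are represented by total functions on R^n that are
   only constrained on the box; the algorithm never evaluates them elsewhere. *)
Definition centroid_mapping A b u Psi : Prop :=
  forall x, box u x ->
    centroid_set A b u (tight_lower x) (tight_upper u x) (Psi x) /\
    (box u (Psi x) -> Psi (Psi x) = Psi x).

Definition update_subroutine A b u Update : Prop :=
  forall x, box u x ->
    [/\ box u (Update x),
        Update x = x <-> optimal A b u x
      & ~ optimal A b u x ->
        norm2 (A *m Update x - b) < norm2 (A *m x - b)].

Definition largest_step u x w (a : R) : Prop :=
  [/\ 0 <= a <= 1, box u (x + a *: (w - x))
    & forall c, 0 <= c <= 1 -> box u (x + c *: (w - x)) -> c <= a].

Definition minor_cycle u Psi x y : Prop :=
  exists2 a, largest_step u x (Psi x) a & y = x + a *: (Psi x - x).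

(* [minor_loop u Psi x k y]: the while loop entered at x exits at y after
   exactly k minor cycles. *)
Inductive minor_loop u Psi : 'cV[R]_n -> nat -> 'cV[R]_n -> Prop :=
| minor_loop_exit x : Psi x = x -> minor_loop u Psi x 0 x
| minor_loop_step x y z k : Psi x <> x -> minor_cycle u Psi x y ->
    minor_loop u Psi y k z -> minor_loop u Psi x k.+1 z.

Definition major_cycle u Update Psi x k y : Prop :=
  minor_loop u Psi (Update x) k y.

(* [algorithm_run u Update Psi x ks y]: started at x, the algorithm halts and
   returns y after [size ks] major cycles, the j-th of which contains
   exactly [nth 0 ks j] minor cycles. *)
Inductive algorithm_run u Update Psi :
    'cV[R]_n -> seq nat -> 'cV[R]_n -> Prop :=
| run_return x y k : major_cycle u Update Psi x k y -> y = Update y ->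
    algorithm_run u Update Psi x [:: k] y
| run_repeat x y z k ks : major_cycle u Update Psi x k y -> y <> Update y ->
    algorithm_run u Update Psi y ks z ->
    algorithm_run u Update Psi x (k :: ks) z.

Lemma minor_cycle_det u Psi x y z :
  minor_cycle u Psi x y -> minor_cycle u Psi x z -> y = z.
Proof.
move=> [a [a01 ba amax] ->] [c [c01 bc cmax] ->].
suff -> : a = c by [].
by apply/le_anti; rewrite amax // cmax.
Qed.

Lemma minor_loop_det u Psi x k y k' y' :
  minor_loop u Psi x k y -> minor_loop u Psi x k' y' -> k = k' /\ y = y'.
Proof.
move=> run; elim: run k' y' => {x k y} [x fx|x y z k nfx xy _ IH] k' y' run'.
  by case: run' fx => {x k' y'} // x y' z' k' nfx.
case: run' nfx xy => {x k' y'} [x fx nfx|x v z' k' nfx' xv vz' _ xy] //.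
have yv := minor_cycle_det xy xv; rewrite -yv in vz'.
by have [-> ->] := IH _ _ vz'.
Qed.

(* Runs are deterministic, so the existence of a halting run from x is
   termination of the algorithm from x. *)
Lemma algorithm_run_det u Update Psi x ks y ks' y' :
  algorithm_run u Update Psi x ks y -> algorithm_run u Update Psi x ks' y' ->
  ks = ks' /\ y = y'.
Proof.
move=> run; elim: run ks' y' => {x ks y} [x y k xy yU|x y z k ks xy yU _ IH].
  move=> ks' y' run'; case: run' xy => {x ks' y'}.
    by move=> x v k' xv _ xy; have [-> ->] := minor_loop_det xy xv.
  move=> x v z k' ks xv vU _ xy; have [_ yv] := minor_loop_det xy xv.
  by case: vU; rewrite -yv.
move=> ks' y' run'; case: run' xy => {x ks' y'}.
  move=> x v k' xv vU xy; have [_ yv] := minor_loop_det xy xv.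
  by case: yU; rewrite yv.
move=> x v z' k' ks' xv vU vz' xy; have [kk yv] := minor_loop_det xy xv.
by rewrite -yv in vz'; have [-> ->] := IH _ _ vz'; rewrite kk.
Qed.

End BoxLeastSquares.

(* Main.v *)
Require Import Defs.
From mathcomp Require Import all_boot all_order all_algebra.
From mathcomp Require Import all_classical all_reals.
From mathcomp Require Import ring lra.

Import Order.TTheory GRing.Theory Num.Theory.
Local Open Scope ring_scope.

(** A centroid mapping sends x to a least-squares minimiser over the affine hull
of the face of the box that contains x; call y stable if it is a fixed point
of Psi, and call |Ay - b| its residual.

Minor cycles. The target Psi x lies in the affine hull of the face of x, so
coordinates of x sitting at a bound stay there along the whole segment from x
to Psi x. Either the full step fits in the box, and then the new point is
stable, or the step is cut short by a coordinate that newly hits a bound. So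
each minor cycle that does not end the loop makes the set of tight coordinates
strictly larger; when all n are tight, the affine hull is a single point and x
is stable. This gives at most n minus the number of tight coordinates minor
cycles ([minor_loop_total]). The norm being convex, and Psi x being at
least as good as x, no minor cycle increases the residual.

Major cycles. Each major cycle ends at a stable point, and the residual of a
stable point is determined by its face, being the minimum over the affine hull
of that face ([stable_residual_le]). If the algorithm does not stop at a
stable point, that point is not optimal and Update strictly lowers the
residual, so later stable points lie on other faces. A face
is described by the state (lower bound, upper bound, in between) of each of
the n coordinates, whence at most 3^n major cycles. [algorithm_run_total]
turns this into an induction on the number of faces that can still occur;
since the algorithm is deterministic, the run it constructs is the only one. *)

(** * Convexity of the Euclidean norm along a segment *)

Lemma ler_norm2 (R : realType) k (v w : 'cV[R]_k) :
  (norm2 v <= norm2 w) = (\sum_(i < k) v i 0 ^+ 2 <= \sum_(i < k) w i 0 ^+ 2).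
Proof. by rewrite /norm2 ler_sqrt // sumr_ge0 // => i _; rewrite sqr_ge0. Qed.

(** On each coordinate this is the convexity of the square: the convex
combination of the squares exceeds the square of the combination by
a(1 - a)(q - p)^2. *)
Lemma norm2_segment_le (R : realType) k (p q : 'cV[R]_k) (a : R) :
  0 <= a <= 1 -> norm2 q <= norm2 p -> norm2 (p + a *: (q - p)) <= norm2 p.
Proof.
move=> /andP[a0 a1]; rewrite !ler_norm2 => qp.
have cvx : \sum_(i < k) (p + a *: (q - p)) i 0 ^+ 2 <=
    \sum_(i < k) ((1 - a) * p i 0 ^+ 2 + a * q i 0 ^+ 2).
  apply: ler_sum => i _; rewrite !mxE -subr_ge0.
  have -> : (1 - a) * p i 0 ^+ 2 + a * q i 0 ^+ 2 -
      (p i 0 + a * (q i 0 - p i 0)) ^+ 2 =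
      (a * (1 - a)) * (q i 0 - p i 0) ^+ 2 by ring.
  by rewrite mulr_ge0 ?sqr_ge0 // mulr_ge0 // subr_ge0.
apply: (le_trans cvx); rewrite big_split /= -!mulr_sumr.
by have := ler_wpM2l a0 qp; lra.
Qed.

(** * The ratio test on one coordinate *)

(** The one-dimensional ratio test. Describing the feasible steps as exactly
those at most r makes the step for the whole box a minimum of finitely many
ratios, so that the largest step is attained. *)
Lemma interval_longest_step (R : realType) (U : \bar R) (x w : R) :
  0 <= x -> (x%:E <= U)%E ->
  exists r, [/\ 0 <= r <= 1,
    forall c, 0 <= c <= 1 ->
      (0 <= x + c * (w - x) /\ ((x + c * (w - x))%:E <= U)%E) <-> c <= r
  & r < 1 -> x + r * (w - x) = 0 \/ (x + r * (w - x))%:E = U].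
Proof.
move=> x0 xU; have [w0|w0] := ltP w 0.
  (* The lower bound is hit on the way to w. *)
  have d0 : 0 < x - w by lra.
  have rE : x + x / (x - w) * (w - x) = 0 by field; rewrite gt_eqF.
  exists (x / (x - w)); split; last by left.
    by rewrite ler_pdivlMr // mul0r ler_pdivrMr //; apply/andP; split; lra.
  move=> c /andP[c0 c1]; rewrite ler_pdivlMr //; split=> [[+ _]|h]; first lra.
  split; first lra.
  by apply: le_trans xU; rewrite lee_fin; have := mulr_ge0 c0 (ltW d0); lra.
have [wU|Uw] := leP w%:E U.
  (* The target lies in the interval: the full step is feasible. *)
  exists 1; split; [lra| |by rewrite ltxx].
  move=> c /andP[c0 c1]; split=> // _; split; first nra.
  case: U xU wU => [U| |] //; rewrite ?leey // !lee_fin => xU wU; nra.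
(* The upper bound, which is then finite, is hit on the way to w. *)
case: U xU Uw => [U| |] //; rewrite ?ltNge ?leey // -?ltNge lee_fin lte_fin.
move=> xU Uw; have d0 : 0 < w - x by lra.
have rE : x + (U - x) / (w - x) * (w - x) = U by field; rewrite gt_eqF.
exists ((U - x) / (w - x)); split; last by right; rewrite rE.
  by rewrite ler_pdivlMr // mul0r ler_pdivrMr //; apply/andP; split; lra.
move=> c /andP[c0 c1]; rewrite ler_pdivlMr // lee_fin; split=> [[_ +]|h].
  by lra.
by split; [have := mulr_ge0 c0 (ltW d0); lra | lra].
Qed.

(** * Faces of the box *)

Section Faces.
Variables (R : realType) (m n : nat) (A : 'M[R]_(m, n)) (b : 'cV[R]_m).
Variables (u : 'I_n -> \bar R).
Implicit Types x y z w : 'cV[R]_n.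

Definition residual x : R := norm2 (A *m x - b).

Lemma residual_segment_le x w a : 0 <= a <= 1 ->
  residual w <= residual x -> residual (x + a *: (w - x)) <= residual x.
Proof.
move=> a01 wx; rewrite /residual.
have -> : A *m (x + a *: (w - x)) - b =
    (A *m x - b) + a *: ((A *m w - b) - (A *m x - b)).
  by rewrite mulmxDr -scalemxAr mulmxBr opprB addrA subrK addrAC.
exact: norm2_segment_le.
Qed.

Definition tight x : {set 'I_n} := tight_lower x :|: tight_upper u x.

Lemma tightP x i : reflect (x i 0 = 0 \/ (x i 0)%:E = u i) (i \in tight x).
Proof.
rewrite !inE; apply: (iffP orP) => -[/eqP|/eqP]; by [left|right].
Qed.

Lemma mem_own_face x : face_space u (tight_lower x) (tight_upper u x) x.
Proof. by split=> i; rewrite inE => /eqP. Qed.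

Lemma face_tight_eq x w i : face_space u (tight_lower x) (tight_upper u x) w ->
  i \in tight x -> w i 0 = x i 0.
Proof.
move=> [w0 w1] /tightP[xi|xi].
  by rewrite w0 ?xi // inE xi.
have : (w i 0)%:E = u i by apply: w1; rewrite inE xi.
by rewrite -xi => -[].
Qed.

Lemma tight_segment x w a :
  face_space u (tight_lower x) (tight_upper u x) w ->
  tight x \subset tight (x + a *: (w - x)).
Proof.
move=> wF; apply/fintype.subsetP => i ti; apply/tightP.
by rewrite !mxE (face_tight_eq _ _ _ wF ti) subrr mulr0 addr0; apply/tightP.
Qed.

(** The step is the minimum of the coordinate ratios; if it is shorter than 1,
a coordinate where the minimum is attained is newly tight. *)
Lemma longest_step_to_face x w :
  box u x -> face_space u (tight_lower x) (tight_upper u x) w ->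
  exists2 a, largest_step u x w a
    & a = 1 \/ tight x \proper tight (x + a *: (w - x)).
Proof.
move=> xB wF.
have /choice[r rP] i := interval_longest_step R (u i) (x i 0) (w i 0)
  (proj1 (xB i)) (proj2 (xB i)).
pose a := \big[Order.min/1]_i r i.
have a_le i : a <= r i by rewrite /a (bigD1 i) //= ge_min lexx.
have a0 : 0 <= a.
  rewrite /a; elim/big_ind: _ => [|s t s0 t0|i _]; first exact: ler01.
    by rewrite le_min s0 t0.
  by have [/andP[]] := rP i.
have a1 : a <= 1.
  by rewrite /a; elim/big_rec: _ => // i s _ s1; rewrite ge_min s1 orbT.
have a01 : 0 <= a <= 1 by rewrite a0.
exists a.
  split=> // [i|c c01 cB].
    by have [_ ri _] := rP i; rewrite !mxE; apply/ri.
  rewrite /a; elim/big_ind: _ => [|s t cs ct|i _]; first by case/andP: c01.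
    by rewrite le_min cs ct.
  by have [_ ri _] := rP i; apply/ri => //; have := cB i; rewrite !mxE.
have [aE|na1] := eqVneq a 1; [by left|right].
have [aE|[i ai]] : a = 1 \/ exists i, a = r i.
- rewrite /a; elim/big_rec: _ => [|i s _ IH]; first by left.
  by rewrite /Order.min; case: ifP => _; [right; exists i | exact: IH].
- by rewrite aE eqxx in na1.
have ri1 : r i < 1 by rewrite -ai lt_neqAle na1.
(* Coordinate i blocks the step, so it becomes tight; it was not tight before,
   since tight coordinates do not move and hence never block. *)
apply/properP; split; first exact: tight_segment.
exists i.
  by apply/tightP; rewrite !mxE ai; have [_ _] := rP i; apply.
apply/negP => ti; have [_ riP _] := rP i.
suff: 1 <= r i by rewrite leNgt ri1.
apply/riP; first by rewrite ler01 lexx.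
by rewrite (face_tight_eq _ _ _ wF ti) subrr mulr0 addr0; apply: xB.
Qed.

(** A coordinate with u i = 0 is at both bounds at once; recording it as being
at the lower bound loses nothing, because u tells whether the upper bound is
attained too. This is what keeps the number of codes at 3^n. *)
Definition face_code x : {ffun 'I_n -> option bool} :=
  [ffun i => if x i 0 == 0 then Some false
             else if (x i 0)%:E == u i then Some true else None].

Lemma face_code_tight x y : face_code x = face_code y ->
  tight_lower x = tight_lower y /\ tight_upper u x = tight_upper u y.
Proof.
move=> /ffunP xy; split; apply/finset.setP => i;
  have := xy i; rewrite !ffunE !inE.
  by do 4?case: ifP.
case: (eqVneq (x i 0) 0) => [x0|_]; case: (eqVneq (y i 0) 0) => [y0|_].
- by rewrite x0 y0.
- by case: ifP.
- by case: ifP.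
- by do 2?case: ifP.
Qed.

(** * Minor and major cycles *)

Section Cycles.
Variables (Update Psi : 'cV[R]_n -> 'cV[R]_n).
Hypothesis hUpdate : update_subroutine A b u Update.
Hypothesis hPsi : centroid_mapping A b u Psi.

Lemma minor_cycle_progress x : box u x ->
  exists y, [/\ minor_cycle u Psi x y, box u y, residual y <= residual x
    & Psi y = y \/ tight x \proper tight y].
Proof.
move=> xB; have [[wF wmin] wid] := hPsi x xB.
have [a aS aP] := longest_step_to_face x (Psi x) xB wF.
have [a01 yB _] := aS.
exists (x + a *: (Psi x - x)); split=> //; first by exists a.
  by apply: residual_segment_le => //; apply/wmin/mem_own_face.
case: aP => [a1|]; [left|by right].
by move: yB; rewrite a1 scale1r addrC subrK => /wid.
Qed.

Lemma tight_all_stable x : box u x -> tight x = [set: 'I_n]%SET -> Psi x = x.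
Proof.
move=> xB xT; apply/matrixP => i j; rewrite ord1.
by have [[wF _] _] := hPsi x xB; apply: face_tight_eq wF _; rewrite xT inE.
Qed.

(** Counting the remaining free coordinates makes the bound additive along the
loop. The final minor cycle, which may leave the tight set unchanged, is paid
for by a coordinate still free: otherwise x would already be stable. *)
Lemma minor_loop_total x : box u x -> exists k y,
  [/\ minor_loop u Psi x k y, (k <= n - #|tight x|)%N, box u y, Psi y = y
    & residual y <= residual x].
Proof.
have [N] := ubnP (n - #|tight x|); elim: N x => // N IH x xN xB.
have [fx|nfx] := pselect (Psi x = x).
  by exists 0%N, x; split=> //; constructor.
have card_le y : (#|tight y| <= n)%N by rewrite -[leqRHS]card_ord max_card.
have xn : (#|tight x| < n)%N.
  rewrite ltn_neqAle card_le andbT; apply/eqP => xn; apply: nfx.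
  apply: tight_all_stable => //; apply/eqP.
  by rewrite eqEcard finset.subsetT cardsT card_ord xn leqnn.
have [y [xy yB yx [fy|/proper_card tight_lt]]] := minor_cycle_progress x xB.
  exists 1%N, y; rewrite subn_gt0; split=> //.
  by apply: minor_loop_step xy _ => //; constructor.
have dec : (n - #|tight y| < n - #|tight x|)%N by rewrite ltn_sub2l.
have [k [z [yz ky zB fz zy]]] := IH y (leq_trans dec xN) yB.
exists k.+1, z; split=> //; last exact: le_trans zy yx.
  exact: minor_loop_step xy yz.
exact: leq_ltn_trans ky dec.
Qed.

(** The faces on which the algorithm can still stop a minor loop once the
residual has come down to rho; its cardinal is the potential that bounds the
number of major cycles. *)
Definition stable_codes (rho : R) : {set {ffun 'I_n -> option bool}} :=
  [set c | `[< exists y,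
    [/\ box u y, Psi y = y, face_code y = c & residual y <= rho] >]]%SET.

Lemma stable_codesP rho c :
  reflect (exists y,
    [/\ box u y, Psi y = y, face_code y = c & residual y <= rho])
    (c \in stable_codes rho).
Proof. by rewrite finset.inE; apply: asboolP. Qed.

(** Both points minimise the residual over the affine hull of their common
face. *)
Lemma stable_residual_le y z : box u y -> box u z -> Psi y = y -> Psi z = z ->
  face_code y = face_code z -> residual y <= residual z.
Proof.
move=> yB zB fy fz /face_code_tight[e0 e1].
have [[_ ymin] _] := hPsi y yB; rewrite fy in ymin.
by apply: ymin; rewrite e0 e1; apply: mem_own_face.
Qed.

(** The code of y is lost when the bound drops below the residual of y: any
stable point on the same face has the same residual. *)
Lemma stable_codes_proper y rho rho' : box u y -> Psi y = y ->
  rho' < residual y <= rho -> stable_codes rho' \proper stable_codes rho.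
Proof.
move=> yB fy /andP[rho'y yrho]; apply/properP; split.
  apply/fintype.subsetP => c /stable_codesP[z [zB fz zc zrho']].
  apply/stable_codesP; exists z; split=> //.
  exact: le_trans zrho' (le_trans (ltW rho'y) yrho).
exists (face_code y); first by apply/stable_codesP; exists y.
apply/stable_codesP => -[z [zB fz zc zrho']].
have := stable_residual_le y z yB zB fy fz (esym zc).
by rewrite leNgt (le_lt_trans zrho').
Qed.

(** The potential is taken at Update x rather than at x: the minor loop that
starts there ends at a stable point whose face is counted, and that face drops
out of the count after the next update, which strictly lowers the residual.
When x is already optimal the single cycle is still paid for. *)
Lemma algorithm_run_total x : box u x -> exists ks z,
  [/\ algorithm_run u Update Psi x ks z, optimal A b u z,
      (size ks <= #|stable_codes (residual (Update x))|)%N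
    & forall k, k \in ks -> (k <= n)%N].
Proof.
have [N] := ubnP #|stable_codes (residual (Update x))|.
elim: N x => // N IH x xN xB.
have [UxB _ _] := hUpdate x xB.
have [k [y [xy kn yB fy yx]]] := minor_loop_total (Update x) UxB.
have {}kn : (k <= n)%N := leq_trans kn (leq_subr _ _).
have [UyB Uopt Udec] := hUpdate y yB.
have [yU|yU] := pselect (y = Update y).
  exists [:: k], y; split=> //; first exact: run_return xy yU.
  - exact/Uopt.
  - rewrite /= card_gt0; apply/finset.set0Pn; exists (face_code y).
    by apply/stable_codesP; exists y.
  - by move=> k'; rewrite inE => /eqP ->.
have dec : residual (Update y) < residual y.
  by apply: Udec => /Uopt /esym.
have /(stable_codes_proper y _ _ yB fy)/proper_card lt :
  residual (Update y) < residual y <= residual (Update x) by rewrite dec.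
have [ks [z [yz zopt ksz ksn]]] := IH y (leq_trans lt xN) yB.
exists (k :: ks), z; split=> //; first exact: run_repeat xy yU yz.
  exact: leq_ltn_trans ksz lt.
by move=> k'; rewrite inE => /orP[/eqP ->|/ksn].
Qed.

End Cycles.
End Faces.

Theorem theorem3p1 (R : realType) (m n : nat)
  (m_gt0 : (0 < m)%N) (n_gt0 : (0 < n)%N)
  (A : 'M[R]_(m, n)) (rkA : \rank A = m) (b : 'cV[R]_m)
  (u : 'I_n -> \bar R) (u_neqNy : forall i, u i <> (-oo)%E)
  (Update Psi : 'cV[R]_n -> 'cV[R]_n)
  (hUpdate : update_subroutine A b u Update)
  (hPsi : centroid_mapping A b u Psi)
  (x0 : 'cV[R]_n) (hx0 : box u x0) :
  (exists ks x, algorithm_run u Update Psi x0 ks x) /\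
  (forall ks x, algorithm_run u Update Psi x0 ks x ->
     [/\ optimal A b u x, (size ks <= 3 ^ n)%N
       & forall k, k \in ks -> (k <= n)%N]).
Proof.
have [ks [z [run zopt ksz ksn]]] :=
  algorithm_run_total R m n A b u Update Psi hUpdate hPsi x0 hx0.
split; first by exists ks, z.
move=> ks' z' /(algorithm_run_det run)[<- <-]; split=> //.
apply: leq_trans ksz (leq_trans (max_card _) _).
by rewrite card_ffun card_option card_bool card_ord.
Qed.
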